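(* Let $\mathbb{T}$ be a time scale, let $a,b\in\mathbb{T}$ with $a<b$, let $[a,b]$ denote the interval $\{t\in\mathbb{T}: a\le t\le b\}$ in $\mathbb{T}$, and let $0\le\alpha\le 1$. Let $f,g:[a,b]\rightarrow\mathbb{R}$ be continuous functions and let $p>1$. Then $$\left[\int_a^b |f(t)+g(t)|^p\,\Diamond_\alpha t\right]^{\frac{1}{p}} \leq \left[\int_a^b |f(t)|^p\,\Diamond_\alpha t\right]^{\frac{1}{p}}+\left[\int_a^b |g(t)|^p\,\Diamond_\alpha t\right]^{\frac{1}{p}}.$$
   Context: A time scale $\mathbb{T}$ is a nonempty closed subset of $\mathbb{R}$, with the topology induced from $\mathbb{R}$. The forward and backward jump operators $\sigma,\rho:\mathbb{T}\to\mathbb{T}$ are $\sigma(t)=\inf\{s\in\mathbb{T}: s>t\}$ and $\rho(t)=\sup\{s\in\mathbb{T}: s<t\}$, with the conventions $\inf\emptyset=\sup\mathbb{T}$ and $\sup\emptyset=\inf\mathbb{T}$. For $a<b$ in $\mathbb{T}$, $[a,b]$ denotes $\{t\in\mathbb{T}: a\le t\le b\}$. A function $F:[a,b]\to\mathbb{R}$ has delta derivative $F^\Delta(t)$ at $t\in[a,b]$, $t<b$, if for every $\varepsilon>0$ there is a neighborhood $U$ of $t$ in $[a,b]$ with $|F(\sigma(t))-F(s)-F^\Delta(t)(\sigma(t)-s)|\le\varepsilon|\sigma(t)-s|$ for all $s\in U$. It has nabla derivative $F^\nabla(t)$ at $t\in[a,b]$, $t>a$, if for every $\varepsilon>0$ there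 is a neighborhood $U$ of $t$ in $[a,b]$ with $|F(\rho(t))-F(s)-F^\nabla(t)(\rho(t)-s)|\le\varepsilon|\rho(t)-s|$ for all $s\in U$. For continuous $f:[a,b]\to\mathbb{R}$, the delta integral is $\int_a^b f(t)\,\Delta t=F(b)-F(a)$, where $F$ is a delta antiderivative of $f$ (a continuous $F:[a,b]\to\mathbb{R}$ with $F^\Delta(t)=f(t)$ for all $t\in[a,b]$, $t<b$); the nabla integral is $\int_a^b f(t)\,\nabla t=G(b)-G(a)$, where $G$ is a nabla antiderivative of $f$ (a continuous $G:[a,b]\to\mathbb{R}$ with $G^\nabla(t)=f(t)$ for all $t\in[a,b]$, $t>a$). Both integrals exist and are well defined for continuous $f$. For $0\le\alpha\le1$, the diamond-$\alpha$ integral is $$\int_a^b f(t)\,\Diamond_\alpha t=\alpha\int_a^b f(t)\,\Delta t+(1-\alpha)\int_a^b f(t)\,\nabla t.$$ *)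

(* Defs.v *)
From HB Require Import structures.
From mathcomp Require Import all_boot all_order all_algebra.
From mathcomp Require Import all_classical all_reals all_analysis.
Set Implicit Arguments.
Unset Strict Implicit.
Unset Printing Implicit Defensive.
Import Order.TTheory GRing.Theory Num.Theory.
Import numFieldNormedType.Exports.
Local Open Scope classical_set_scope.
Local Open Scope ring_scope.

(* Functions on the time scale interval [ts_itv T a b] are encoded as functions
   on [R]; every notion below only looks at their values on [ts_itv T a b]. *)

Definition is_time_scale (R : realType) (T : set R) : Prop :=
  T !=set0 /\ closed T.

Definition ts_itv (R : realType) (T : set R) (a b : R) : set R :=
  [set t | T t /\ a <= t <= b].

(* The empty case is separate because the library sets [inf set0 = 0].  For
   closed [T] and [t] in [T], it only arises when [T] has a greatest element,
   so [sup T] is then the true supremum. *)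
Definition ts_sigma (R : realType) (T : set R) (t : R) : R :=
  if pselect ([set s | T s /\ t < s] !=set0)
  then inf [set s | T s /\ t < s] else sup T.

Definition ts_rho (R : realType) (T : set R) (t : R) : R :=
  if pselect ([set s | T s /\ s < t] !=set0)
  then sup [set s | T s /\ s < t] else inf T.

(* The filter [within (ts_itv T a b) (nbhs t)] consists of the neighborhoods of
   [t] in [ts_itv T a b]; these contain [t] itself. *)
Definition is_delta_derivative (R : realType) (T : set R) (a b : R)
    (F : R -> R) (t d : R) : Prop :=
  forall e : R, 0 < e -> \forall s \near within (ts_itv T a b) (nbhs t),
    `|F (ts_sigma T t) - F s - d * (ts_sigma T t - s)|
      <= e * `|ts_sigma T t - s|.

Definition is_nabla_derivative (R : realType) (T : set R) (a b : R)
    (F : R -> R) (t d : R) : Prop :=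
  forall e : R, 0 < e -> \forall s \near within (ts_itv T a b) (nbhs t),
    `|F (ts_rho T t) - F s - d * (ts_rho T t - s)|
      <= e * `|ts_rho T t - s|.

Definition delta_antiderivative (R : realType) (T : set R) (a b : R)
    (f F : R -> R) : Prop :=
  {within ts_itv T a b, continuous F} /\
  forall t, ts_itv T a b t -> t < b -> is_delta_derivative T a b F t (f t).

Definition nabla_antiderivative (R : realType) (T : set R) (a b : R)
    (f G : R -> R) : Prop :=
  {within ts_itv T a b, continuous G} /\
  forall t, ts_itv T a b t -> a < t -> is_nabla_derivative T a b G t (f t).

(* [xget] picks an antiderivative.  Its default value matters only when there is
   none, which does not happen for [f] continuous on [ts_itv T a b]; the
   resulting increment does not depend on the antiderivative picked. *)
Definition delta_integral (R : realType) (T : set R) (a b : R)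
    (f : R -> R) : R :=
  let F := xget (cst 0 : R -> R) [set F | delta_antiderivative T a b f F] in
  F b - F a.

Definition nabla_integral (R : realType) (T : set R) (a b : R)
    (f : R -> R) : R :=
  let G := xget (cst 0 : R -> R) [set G | nabla_antiderivative T a b f G] in
  G b - G a.

Definition diamond_integral (R : realType) (T : set R) (alpha a b : R)
    (f : R -> R) : R :=
  alpha * delta_integral T a b f + (1 - alpha) * nabla_integral T a b f.

(* Main.v *)
(* The diamond integral is monotone and linear on continuous functions, because a
   function with nonnegative delta derivative increases, and because delta
   antiderivatives exist.  The latter are built as the pointwise supremum of the
   subsolutions H, those with H v - H u <= hi * (v - u) whenever f <= hi on
   [u, v[; the nabla case is the delta case of the reflected time scale -T.
   For u, v above the two right-hand norms, convexity of x |-> x^p gives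
     |f + g|^p <= (u + v)^p * (u/(u+v) * (|f|/u)^p + v/(u+v) * (|g|/v)^p),
   and integrating bounds the left-hand norm by u + v. *)
Require Import Defs.
From HB Require Import structures.
From mathcomp Require Import all_boot all_order all_algebra.
From mathcomp Require Import all_classical all_reals all_analysis.
From mathcomp Require Import lra ring.
Import Order.TTheory GRing.Theory Num.Theory.
Import numFieldNormedType.Exports.
Local Open Scope classical_set_scope.
Local Open Scope ring_scope.

(** * Epsilon-delta forms of the topology, and clamping to an interval *)

Lemma near_within_distP (R : realType) (K : set R) (t : R) (P : R -> Prop) :
  (\forall s \near within K (nbhs t), P s) <->
  exists2 d : R, 0 < d & forall s, K s -> `|t - s| < d -> P s.
Proof.
split.
  move=> /nbhs_normP[d /= d0 dP]; exists d => // s Ks ts.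
  by apply: dP.
case=> d d0 dP; apply/nbhs_normP; exists d => // s /= ts Ks.
exact: dP.
Qed.

Lemma within_continuous_distP (R : realType) (K : set R) (f : R -> R) :
  {within K, continuous f} <->
  forall t e, K t -> 0 < e ->
    exists2 d : R, 0 < d & forall s, K s -> `|t - s| < d -> `|f t - f s| < e.
Proof.
split.
  move=> /subspace_continuousP cf t e Kt e0.
  by have /cvgrPdist_lt/(_ e e0)/near_within_distP := cf t Kt.
move=> cf; apply/subspace_continuousP => t Kt; apply/cvgrPdist_lt => e e0.
by apply/near_within_distP; exact: cf.
Qed.

Lemma limit_point_closed (R : realType) (A : set R) (x : R) : closed A ->
  (forall d, 0 < d -> exists2 s, A s & `|x - s| < d) -> A x.
Proof.
move=> cA xA; apply: cA => B /nbhs_normP[d /= d0 dB].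
by have [s As xs] := xA d d0; exists s; split => //; exact: dB.
Qed.

(** [max u (min x v)] is the projection of [x] onto the interval from [u] to [v]. When it moves
    strictly, the projection of [x] is a common point of [u, v[ and [x, y[, at which bounds known on
    each of them can be compared. *)
Lemma clamp_lt (d : Order.disp_t) (R : orderType d) (u v x y : R) : (u <= v)%O ->
  (Order.max u (Order.min x v) < Order.max u (Order.min y v))%O ->
  let c := Order.max u (Order.min x v) in (u <= c < v)%O && (x <= c < y)%O.
Proof.
move=> uv /= cxy; rewrite le_max lexx /=.
have cv : (Order.max u (Order.min x v) < v)%O.
  by apply: lt_le_trans cxy _; rewrite ge_max uv ge_min lexx orbT.
have xv : (x < v)%O.
  by move: cv; rewrite gt_max => /andP[_]; rewrite gt_min ltxx orbF.
rewrite cv le_max (min_l (ltW xv)) lexx orbT /=.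
move: cxy; rewrite (min_l (ltW xv)) lt_max lt_min => /orP[|/andP[]//].
by rewrite gt_max ltxx.
Qed.
Lemma clamp_le (d : Order.disp_t) (R : orderType d) (u v x y : R) : (x <= y)%O ->
  (Order.max u (Order.min x v) <= Order.max u (Order.min y v))%O.
Proof.
by move=> xy; rewrite ge_max !le_max lexx /= le_min !ge_min xy lexx !orbT.
Qed.

(** * The forward jump, and monotonicity from a nonnegative delta derivative *)

Section delta.
Context {R : realType} (T : set R) (a b : R).
Hypotheses (cT : closed T) (Ta : T a) (Tb : T b) (ab : a < b).
Local Notation K := (ts_itv T a b).
Local Notation sg := (ts_sigma T).

Lemma ts_itv_left : K a. Proof. by split=> //; rewrite lexx ltW. Qed.

Lemma ts_itv_right : K b. Proof. by split=> //; rewrite lexx ltW. Qed.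

(** Since [b] lies to the right of [t], the jump is a true infimum, attained in [T] by closedness.
    The last clause provides points just to the right of [t] when [t] is right-dense. *)
Lemma ts_sigma_spec t : t < b ->
  [/\ T (sg t), t <= sg t <= b, (forall s, T s -> t < s -> sg t <= s)
    & forall d, 0 < d -> exists2 s, T s & t < s < sg t + d].
Proof.
move=> tb; rewrite /ts_sigma; case: pselect => [ne|]; last by case; exists b.
set A := [set s | T s /\ t < s].
have lA : has_lbound A by exists t => s [_ /ltW].
have h1 s : T s -> t < s -> inf A <= s by move=> Ts ts; exact: ge_inf.
have h2 d : 0 < d -> exists2 s, T s & t < s < inf A + d.
  by move=> d0; have [s [Ts ts] sA] := inf_adherent d0 (conj ne lA);
    exists s => //; rewrite ts.
split => //; last first.
  by rewrite h1// andbT; apply: lb_le_inf => // s [_ /ltW].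
apply: limit_point_closed => // d /h2[s Ts /andP[ts sd]]; exists s => //.
by have := h1 s Ts ts => ?; rewrite ler0_norm; lra.
Qed.

Lemma ts_sigma_itv t : K t -> t < b -> K (sg t).
Proof.
by move=> [Tt /andP[at_ _]] /ts_sigma_spec[Ts /andP[ts ?] _ _]; split=> //; lra.
Qed.

(** Induction along the time scale: with a slack of slope [e], the set of points up to which the
    bound holds contains its supremum by continuity, and the derivative condition pushes it past any
    supremum below [b]. *)
Lemma delta_derivative_ge0_le (H : R -> R) :
  {within K, continuous H} ->
  (forall t, K t -> t < b -> exists2 d, 0 <= d & is_delta_derivative T a b H t d) ->
  H a <= H b.
Proof.
move=> /within_continuous_distP cH dH.
suff key e : 0 < e -> H a - e * (b - a) <= H b.
  apply/ler_addgt0Pr => e e0; have := key (e / (b - a)).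
  rewrite divr_gt0 ?subr_gt0// divfK ?subr_eq0 ?gt_eqF// => /(_ isT) ?; lra.
move=> e0.
pose P t := H a - e * (t - a) <= H t.
pose S := [set t | K t /\ forall s, K s -> s <= t -> P s].
have Sa : S a.
  split; first exact: ts_itv_left.
  by move=> s [_ /andP[as_ _]] sa; rewrite /P (@le_anti _ _ s a) ?sa//; lra.
have Sb : has_ubound S by exists b => s [[_ /andP[]]].
pose c := sup S.
have near_c d : 0 < d -> exists2 s, S s & c - d < s.
  by move=> d0; apply: sup_adherent => //; split => //; exists a.
have leS s : S s -> s <= c by move=> Ss; exact: ub_le_sup.
have Kc : K c.
  split; last first.
    rewrite leS//=; apply: ge_sup; first by exists a.
    by move=> s [[_ /andP[]]].
  apply: limit_point_closed => // d d0.
  have [s Ss sc] := near_c d d0.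
  have [[Ts _] _] := Ss; exists s => //.
  by have := leS s Ss => ?; rewrite ger0_norm; lra.
have lt_P s : K s -> s < c -> P s.
  move=> Ks sc; have [|s' [_ Ss'] ss'] := near_c (c - s).
    by rewrite subr_gt0.
  by apply: Ss' => //; apply: ltW; lra.
(* If the bound failed at [c], continuity with half the gap as tolerance would make it fail at
   points of [S] just below [c] too. *)
have Pc : P c.
  rewrite /P leNgt; apply/negP => Hc.
  have [|d d0 dH'] := cH c ((H a - e * (c - a) - H c) / 2) Kc; first by lra.
  have [s Ss sc] := near_c d d0.
  have sc' := leS s Ss.
  have [Ks /(_ s Ks (lexx _))] := Ss; rewrite /P => Hs.
  have : `|H c - H s| < (H a - e * (c - a) - H c) / 2.
    by apply: dH' => //; rewrite ger0_norm; lra.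
  have : e * (s - a) <= e * (c - a) by rewrite ler_pM2l//; lra.
  by move=> ?; rewrite ltr_norml => /andP[? ?]; lra.
have Sc : S c.
  split => // s Ks; rewrite le_eqVlt => /orP[/eqP -> //|]; exact: lt_P.
have [cb|bc] := ltP c b; last first.
  suff <- : c = b by [].
  by apply/le_anti; rewrite bc andbT; case: Kc => _ /andP[].
have [d d0 /(_ e e0)/near_within_distP[r r0 rH]] := dH c Kc cb.
have [Tsg /andP[csg sgb] sgle sgd] := ts_sigma_spec c cb.
have step s : K s -> c < s -> s - c < r -> sg c = c -> P s.
  move=> Ks cs sr sgc; have := rH s Ks; rewrite sgc.
  rewrite ler0_norm; last lra.
  move=> /(_ ltac:(lra)); rewrite ler_norml => /andP[_].
  have ds : 0 <= d * (s - c) by rewrite mulr_ge0//; lra.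
  have := Pc; rewrite /P; nra.
(* If [c] is right-dense, some point of [T] within [r] to the right of [c], capped at [b], belongs
   to [S], contradicting the choice of [c]. *)
move: csg; rewrite le_eqVlt => /orP[/eqP csg|csg].
  have [s0 Ts0 /andP[cs0 s0r]] := sgd r r0.
  pose s1 := Num.min s0 b.
  have Ts1 : T s1 by rewrite /s1; case: ltP.
  have s1b : s1 <= b by rewrite /s1 ge_min lexx orbT.
  have s10 : s1 <= s0 by rewrite /s1 ge_min lexx.
  have cs1 : c < s1 by rewrite /s1 lt_min cs0.
  suff /leS : S s1 by rewrite leNgt cs1.
  have ac : a <= c by case: Kc => _ /andP[].
  split; first by split => //; lra.
  move=> s Ks ss1; have [sc|cs] := leP s c; first by case: Sc => _; apply.
  by apply: step => //; lra.
(* If [c] is right-scattered, the only new point to check is [sg c], where the bound follows from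
   the derivative condition at [s = c]. *)
suff /leS : S (sg c) by rewrite leNgt csg.
split; first exact: ts_sigma_itv.
move=> s Ks ssg; have [sc|cs] := leP s c; first by case: Sc => _; apply.
have -> : s = sg c by apply/le_anti; rewrite ssg sgle//; case: Ks.
have := rH c Kc; rewrite subrr normr0 => /(_ r0).
rewrite [`|sg c - c|]ger0_norm; last lra.
rewrite ler_norml => /andP[? _].
have ds : 0 <= d * (sg c - c) by rewrite mulr_ge0//; lra.
have := Pc; rewrite /P; nra.
Qed.

(** * Existence of delta antiderivatives *)

Lemma ts_itv_bounded (f : R -> R) : {within K, continuous f} ->
  exists M, forall t, K t -> `|f t| <= M.
Proof.
move=> cf.
have cK : compact K.
  have -> : K = T `&` `[a, b]%classic.
    by apply/seteqP; split => t; rewrite /ts_itv /= in_itv.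
  rewrite setIC; apply: compact_closedI => //; exact: segment_compact.
have /compact_bounded[M [_ /(_ (M + 1))bM]] := continuous_compact cf cK.
by exists (M + 1) => t Kt; apply: bM; [rewrite ltrDl|exists t].
Qed.

(** The interval is half-open because across a gap from [u] to its successor the delta integral sees
    only [f u]. *)
Definition delta_subsolution (f H : R -> R) := forall u v hi,
  K u -> K v -> u <= v -> (forall r, K r -> u <= r < v -> f r <= hi) ->
  H v - H u <= hi * (v - u).

(** A Perron-type construction: the supremum of the subsolutions vanishing at [a] is again a
    subsolution, and being the largest one forces the matching lower bound. *)
Lemma mean_bounds_exist (f : R -> R) (M : R) :
  (forall t, K t -> `|f t| <= M) ->
  exists2 F, delta_subsolution f F & forall u v lo,
    K u -> K v -> u <= v -> (forall r, K r -> u <= r < v -> lo <= f r) ->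
    lo * (v - u) <= F v - F u.
Proof.
move=> fM.
have Ka : K a by exact: ts_itv_left.
pose V t := [set H t | H in [set H | delta_subsolution f H /\ H a = 0]].
pose F t := sup (V t).
have V0 t : V t !=set0.
  (* The line of slope [- M] is a subsolution, because any [hi] bounding [f] on a nonempty [u, v[ is
     at least [f u], hence at least [- M]. *)
  exists (- M * (t - a)), (fun t => - M * (t - a)) => //; split; last by ring.
  move=> u v hi Ku Kv uv fhi; rewrite -mulrBr (_ : v - a - (u - a) = v - u); last by ring.
  move: uv; rewrite le_eqVlt => /orP[/eqP ->|uv]; first by rewrite subrr !mulr0.
  have vu : 0 <= v - u by lra.
  rewrite (ler_wpM2r vu)//.
  have := fhi u Ku; rewrite lexx uv => /(_ isT).
  have := fM u Ku; rewrite ler_norml => /andP[? _]; lra.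
have leF t H : K t -> delta_subsolution f H -> H a = 0 -> H t <= F t.
  move=> Kt sH Ha; apply: ub_le_sup; last by exists H.
  exists (M * (t - a)) => _ [G [sG Ga] <-].
  have at_ : a <= t by case: Kt => _ /andP[].
  have := sG a t M Ka Kt at_; rewrite Ga subr0; apply.
  by move=> r Kr _; have := fM r Kr; rewrite ler_norml => /andP[].
have Fsub : delta_subsolution f F.
  move=> u v hi Ku Kv uv fhi; rewrite lerBlDr; apply: ge_sup => // _ [H [sH Ha] <-].
  by have := sH u v hi Ku Kv uv fhi; have := leF u H Ku sH Ha; lra.
have Fa : F a = 0.
  apply/le_anti/andP; split.
    by apply: ge_sup => // _ [H [_ Ha] <-]; rewrite Ha.
  have [_ [H [sH Ha] _]] := V0 a; rewrite -Ha; exact: leF.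
exists F => // u v lo Ku Kv uv flo.
(* Giving [F] slope [lo] on [u, v] keeps it a subsolution, so the lower bound
   follows from the maximality of [F]. *)
pose G t := F (Num.min t u) - F a + lo * (Num.max u (Num.min t v) - u)
            + (F (Num.max t v) - F v).
have au : a <= u by case: Ku => _ /andP[].
have ub : u <= b by case: Ku => _ /andP[].
have Ga : G a = 0.
  by rewrite /G (min_l au) (min_l (le_trans au uv)) (max_l au) (max_r (le_trans au uv)); lra.
have Gv : G v = F u + lo * (v - u).
  by rewrite /G (min_r uv) minxx maxxx (max_r uv) Fa; lra.
have sG : delta_subsolution f G.
  have Kmin x y : K x -> K y -> K (Num.min x y) by rewrite /Num.min; case: ifP.
  have Kmax x y : K x -> K y -> K (Num.max x y) by rewrite /Num.max; case: ifP.
  move=> x y hi Kx Ky xy fhi.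
  have h1 : F (Num.min y u) - F (Num.min x u) <= hi * (Num.min y u - Num.min x u).
    apply: Fsub; [exact: Kmin|exact: Kmin| |].
      by case: (leP x u) (leP y u) => ? [] ?; lra.
    move=> r Kr; rewrite lt_min ge_min => /andP[/orP[] xr /andP[ry ru]];
      apply: fhi => //; lra.
  have h3 : F (Num.max y v) - F (Num.max x v) <= hi * (Num.max y v - Num.max x v).
    apply: Fsub; [exact: Kmax|exact: Kmax| |].
      by case: (leP x v) (leP y v) => ? [] ?; lra.
    move=> r Kr; rewrite lt_max ge_max => /andP[/andP[xr vr] /orP[] ry];
      apply: fhi => //; lra.
  pose cl t := Num.max u (Num.min t v).
  (* If the middle piece has positive length, [cl x] lies in both [u, v[ and [x, y[, so
     [lo <= f (cl x) <= hi]. *)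
  have h2 : lo * (cl y - cl x) <= hi * (cl y - cl x).
    have := @clamp_le _ _ u v x y xy; rewrite -/(cl x) -/(cl y).
    rewrite le_eqVlt => /orP[/eqP ->|clxy]; first by rewrite subrr !mulr0.
    have clxy0 : 0 <= cl y - cl x by lra.
    rewrite (ler_wpM2r clxy0)//.
    have /andP[cuv cxy] := @clamp_lt _ _ u v x y uv clxy.
    have Kc : K (cl x) by apply: Kmax => //; exact: Kmin.
    by apply: (@le_trans _ _ (f (cl x))); [exact: flo|exact: fhi].
  (* Hence the lengths of the pieces below [u], inside [u, v] and above [v] add up to [y - x]. *)
  have cE t : Num.min t u + cl t + Num.max t v = t + u + v.
    rewrite /cl; have [tu|/ltW ut] := leP t u.
      by rewrite (min_l (le_trans tu uv)) (max_l tu) (max_r (le_trans tu uv)).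
    have [tv|/ltW vt] := leP t v; first by rewrite (max_r ut); ring.
    by rewrite (max_r uv); ring.
  rewrite (_ : hi * (y - x) = hi * (Num.min y u - Num.min x u) + hi * (cl y - cl x)
     + hi * (Num.max y v - Num.max x v)); last first.
    by rewrite -!mulrDr; congr (_ * _); have := cE x; have := cE y; lra.
  by move: h1 h2 h3; rewrite /G /cl; lra.
by have := leF v G Kv sG Ga; rewrite Gv; lra.
Qed.

(** The two mean bounds confine the slope of [F] to within [e] of [c] wherever [f] is within [e] of
    [c]. Taking [c = 0] gives a Lipschitz bound, and taking [c = f t] gives the derivative. *)
Lemma delta_antiderivative_exists (f : R -> R) : {within K, continuous f} ->
  exists F, delta_antiderivative T a b f F.
Proof.
move=> cf; have [M fM] := ts_itv_bounded f cf.
have [F Fhi Flo] := mean_bounds_exist f M fM.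
have est u v c e : K u -> K v -> u <= v ->
    (forall r, K r -> u <= r < v -> `|c - f r| <= e) ->
    `|F v - F u - c * (v - u)| <= e * (v - u).
  move=> Ku Kv uv fr.
  have h1 : F v - F u <= (c + e) * (v - u).
    by apply: Fhi => // r Kr rr; have := fr r Kr rr; rewrite ler_norml; lra.
  have h2 : (c - e) * (v - u) <= F v - F u.
    by apply: Flo => // r Kr rr; have := fr r Kr rr; rewrite ler_norml; lra.
  by move: h1 h2; rewrite mulrDl mulrBl ler_norml; lra.
(* The constant is [M + 1] rather than [M] so that it is positive and can be divided by. *)
have lip u v : K u -> K v -> `|F u - F v| <= (M + 1) * `|u - v|.
  wlog uv : u v / v <= u.
    move=> h Ku Kv; have [/h|/ltW/h] := leP v u; first exact.
    by rewrite distrC [`|v - u|]distrC; exact.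
  move=> Ku Kv; have := est v u 0 (M + 1) Kv Ku uv; rewrite mul0r subr0.
  rewrite [`|u - v|]ger0_norm ?subr_ge0//; apply => r Kr _.
  by rewrite sub0r normrN; have := fM r Kr; lra.
exists F; split.
  apply/within_continuous_distP => t e Kt e0.
  have M0 : 0 < M + 1 by have := fM t Kt; have := normr_ge0 (f t); lra.
  exists (e / (M + 1)); first by rewrite divr_gt0.
  move=> s Ks; rewrite ltr_pdivlMr// mulrC; apply: le_lt_trans; exact: lip.
move=> t Kt tb e e0; apply/near_within_distP.
have /within_continuous_distP/(_ t e Kt e0)[d d0 fd] := cf.
have [Ts /andP[ts sb] sle _] := ts_sigma_spec t tb.
have Ks : K (sg t) by exact: ts_sigma_itv.
(* At a right-scattered [t] the radius stays within the gap, so that every admissible [s] satisfies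
   [s <= t]. *)
exists (if t < sg t then Num.min d (sg t - t) else d).
  by case: ifP => //; rewrite lt_min d0 subr_gt0.
move=> s Kxs st.
have std : `|t - s| < d by case: ifP st => //; rewrite lt_min => _ /andP[].
have ss : t < sg t -> s <= t.
  move=> tsg; move: st; rewrite tsg lt_min => /andP[_ st].
  rewrite leNgt; apply/negP => lts.
  have := sle s; case: Kxs => Tss _ /(_ Tss lts).
  by move: st; rewrite ler0_norm; lra.
(* For [s <= sg t], every point of [s, sg t[ lies at or before [t], so it is within [d] of [t].
   Otherwise [t] must be right-dense and the estimate is applied on [t, s[. *)
have [ssg|sgs] := leP s (sg t).
  rewrite [`|sg t - s|]ger0_norm ?subr_ge0//; apply: est => // r Kr /andP[sr rs].
  have rt : r <= t.
    rewrite leNgt; apply/negP => tr; have := sle r; case: Kr => Tr _ /(_ Tr tr); lra.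
  by apply: ltW; apply: fd => //; move: std; rewrite !ltr_norml; lra.
have tE : sg t = t.
  by apply/le_anti; rewrite ts andbT leNgt; apply/negP => /[dup] /ss; lra.
rewrite tE in sgs *.
have -> : F t - F s - f t * (t - s) = - (F s - F t - f t * (s - t)) by ring.
rewrite normrN [`|t - s|]distrC [`|s - t|]ger0_norm ?subr_ge0 ?(ltW sgs)//.
apply: est => //; first exact: ltW.
move=> r Kr /andP[tr rs]; apply: ltW; apply: fd => //.
by move: std; rewrite !ltr_norml; lra.
Qed.

End delta.

(** * Linearity and monotonicity of the delta integral *)

Lemma is_delta_derivative_lin (R : realType) (T : set R) (a b : R) (F G : R -> R)
    (t c d k l : R) :
  is_delta_derivative T a b F t c -> is_delta_derivative T a b G t d ->
  is_delta_derivative T a b (fun s => k * F s + l * G s) t (k * c + l * d).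
Proof.
move=> dF dG e e0.
(* The summand 1 keeps [m] positive even when [k] and [l] both vanish. *)
pose m := `|k| + `|l| + 1.
have m0 : 0 < m by rewrite ltr_wpDl// addr_ge0.
have em0 : 0 < e / m by rewrite divr_gt0.
have /near_within_distP[r r0 rF] := dF _ em0.
have /near_within_distP[r' r'0 rG] := dG _ em0.
apply/near_within_distP; exists (Num.min r r'); first by rewrite lt_min r0.
move=> s Ks; rewrite lt_min => /andP[/(rF s Ks) hF /(rG s Ks) hG].
set x := ts_sigma T t - s in hF hG *; set y := ts_sigma T t in hF hG *.
have -> : k * F y + l * G y - (k * F s + l * G s) - (k * c + l * d) * x =
  k * (F y - F s - c * x) + l * (G y - G s - d * x) by ring.
rewrite (le_trans (ler_normD _ _))// !normrM.
apply: (@le_trans _ _ ((`|k| + `|l|) * (e / m * `|x|))).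
  by rewrite mulrDl lerD// ler_wpM2l.
rewrite mulrA ler_wpM2r// mulrCA (ler_piMr (ltW e0))// ler_pdivrMr// mul1r.
by rewrite lerDl.
Qed.

Lemma delta_antiderivative_lin (R : realType) (T : set R) (a b : R)
    (f g F G : R -> R) (k l : R) :
  delta_antiderivative T a b f F -> delta_antiderivative T a b g G ->
  delta_antiderivative T a b (fun s => k * f s + l * g s)
    (fun s => k * F s + l * G s).
Proof.
move=> [cF dF] [cG dG]; split; last first.
  by move=> t Kt tb; apply: is_delta_derivative_lin; [exact: dF|exact: dG].
apply/subspace_continuousP => t Kt.
move/subspace_continuousP: cF => /(_ t Kt) cF.
move/subspace_continuousP: cG => /(_ t Kt) cG.
by apply: cvgD; apply: cvgM => //; exact: cvg_cst.
Qed.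

Lemma delta_antiderivative_le (R : realType) (T : set R) (a b : R)
    (f g F G : R -> R) :
  closed T -> T a -> T b -> a < b ->
  delta_antiderivative T a b f F -> delta_antiderivative T a b g G ->
  (forall t, ts_itv T a b t -> f t <= g t) -> F b - F a <= G b - G a.
Proof.
move=> cT Ta Tb ab aF aG fg.
have [cH dH] := @delta_antiderivative_lin _ _ _ _ _ _ _ _ 1 (-1) aG aF.
have := @delta_derivative_ge0_le _ _ _ _ cT Ta Tb ab _ cH.
rewrite !mul1r !mulN1r => h; suff : G a - F a <= G b - F b by lra.
apply: h => t Kt tb; exists (1 * g t + -1 * f t); last exact: dH.
by have := fg t Kt; lra.
Qed.

(** Comparing two antiderivatives of the same [f] in both directions shows that the choice made by
    [xget] is immaterial. *)
Lemma delta_integralE (R : realType) (T : set R) (a b : R) (f F : R -> R) :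
  closed T -> T a -> T b -> a < b ->
  delta_antiderivative T a b f F -> delta_integral T a b f = F b - F a.
Proof.
move=> cT Ta Tb ab aF; rewrite /delta_integral /=.
set G := xget _ _.
have aG : delta_antiderivative T a b f G.
  by rewrite /G; apply: xgetPex; exists F.
by apply/le_anti/andP; split; apply: (@delta_antiderivative_le _ T a b f f).
Qed.

(** Monotonicity and linearity are packed into one inequality, the form in which the integral enters
    the final estimate. *)
Lemma delta_integral_le_lin (R : realType) (T : set R) (a b : R)
    (f g h : R -> R) (k l : R) :
  closed T -> T a -> T b -> a < b ->
  {within ts_itv T a b, continuous f} -> {within ts_itv T a b, continuous g} ->
  {within ts_itv T a b, continuous h} ->
  (forall t, ts_itv T a b t -> f t <= k * g t + l * h t) ->
  delta_integral T a b f <=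
    k * delta_integral T a b g + l * delta_integral T a b h.
Proof.
move=> cT Ta Tb ab cf cg ch fgh.
have [F aF] := @delta_antiderivative_exists _ T a b cT Ta Tb ab f cf.
have [G aG] := @delta_antiderivative_exists _ T a b cT Ta Tb ab g cg.
have [H aH] := @delta_antiderivative_exists _ T a b cT Ta Tb ab h ch.
rewrite (delta_integralE _ _ _ _ _ _ cT Ta Tb ab aF).
rewrite (delta_integralE _ _ _ _ _ _ cT Ta Tb ab aG).
rewrite (delta_integralE _ _ _ _ _ _ cT Ta Tb ab aH).
have aL := @delta_antiderivative_lin _ _ _ _ _ _ _ _ k l aG aH.
by have := @delta_antiderivative_le _ _ _ _ _ _ _ _ cT Ta Tb ab aF aL fgh; lra.
Qed.

(** * Transfer to the nabla integral by reflection *)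

Definition ts_opp {R : realType} (T : set R) : set R := [set t | T (- t)].

Lemma ts_itv_opp (R : realType) (T : set R) (a b t : R) :
  ts_itv (ts_opp T) (- b) (- a) t <-> ts_itv T a b (- t).
Proof.
rewrite /ts_itv /ts_opp /= [a <= - t]lerNr [- t <= b]lerNl.
by rewrite [_ && (t <= _)]andbC.
Qed.

(** Negation exchanges infima and suprema; the conventions for empty sets correspond as well. *)
Lemma ts_sigma_opp (R : realType) (T : set R) (t : R) :
  ts_sigma (ts_opp T) (- t) = - ts_rho T t.
Proof.
have oppE (A : set R) : [set - x | x in [set s | A (- s)]] = A.
  apply/seteqP; split=> x; first by case=> y /= Ay <-.
  by exists (- x); rewrite /= opprK.
have setE : [set s | ts_opp T s /\ - t < s] = [set s | [set s | T s /\ s < t] (- s)].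
  by apply/seteqP; split => s /=; rewrite /ts_opp /= ltrNl.
rewrite /ts_sigma /ts_rho setE.
have ne : ([set s | [set s | T s /\ s < t] (- s)] !=set0) <->
          ([set s | T s /\ s < t] !=set0).
  split=> -[s hs]; exists (- s) => //=; rewrite ?opprK//.
case: pselect => [h|h]; case: pselect => [h'|h'].
- by rewrite /inf oppE.
- by case: h'; apply/ne.
- by case: h; apply/ne.
rewrite /inf opprK; congr sup.
apply/seteqP; split=> x; first by exists (- x); rewrite /= ?opprK.
by case=> y Ty <-; rewrite /ts_opp /= opprK.
Qed.

Lemma closed_ts_opp (R : realType) (T : set R) : closed T -> closed (ts_opp T).
Proof.
move=> cT; apply: (@preimage_closed _ _ -%R) => // x _.
exact: oppr_continuous.
Qed.

Lemma within_continuous_opp (R : realType) (T : set R) (a b : R) (f : R -> R) :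
  {within ts_itv T a b, continuous f} <->
  {within ts_itv (ts_opp T) (- b) (- a), continuous (fun t => f (- t))}.
Proof.
split=> /within_continuous_distP cf; apply/within_continuous_distP => t e.
  move=> /ts_itv_opp Kt e0; have [d d0 df] := cf _ _ Kt e0; exists d => // s /ts_itv_opp Ks ts.
  by apply: df => //; rewrite -opprD normrN.
move=> Kt e0; have [|d d0 df] := cf (- t) e _ e0.
  by apply/ts_itv_opp; rewrite opprK.
exists d => // s Ks ts; have := df (- s); rewrite !opprK; apply.
  by apply/ts_itv_opp; rewrite opprK.
by rewrite addrC distrC.
Qed.

(** Reflecting the argument reverses the sign of the derivative; the outer minus sign in [- G (- t)]
    restores it. *)
Lemma nabla_antiderivative_opp (R : realType) (T : set R) (a b : R)
    (f G : R -> R) :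
  nabla_antiderivative T a b f G <->
  delta_antiderivative (ts_opp T) (- b) (- a) (fun t => f (- t)) (fun t => - G (- t)).
Proof.
have cN (K : set R) (F : R -> R) : {within K, continuous F} <-> {within K, continuous (fun t => - F t)}.
  have distN t s : `|- F t - - F s| = `|F t - F s| by rewrite -opprB normrN opprK addrC.
  by split=> /within_continuous_distP cF; apply/within_continuous_distP => t e Kt e0;
    have [d d0 dF] := cF t e Kt e0; exists d => // s Ks /(dF s Ks); rewrite distN.
have dE t d : is_delta_derivative (ts_opp T) (- b) (- a) (fun t => - G (- t)) (- t) d
    <-> is_nabla_derivative T a b G t d.
  have E' s x : `|- x - s| = `|x - - s| :> R by rewrite -normrN opprD !opprK.
  have E s x : `|- G (- - x) - - G (- s) - d * (- x - s)| =
      `|G x - G (- s) - d * (x - - s)|.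
    by rewrite -normrN; congr (`| _ |); rewrite opprK; ring.
  split=> dG e e0; have /near_within_distP[r r0 rG] := dG e e0;
    apply/near_within_distP; exists r => // s.
    move=> Ks ts; have := rG (- s); rewrite ts_sigma_opp E !E' !opprK; apply => //.
    by apply/ts_itv_opp; rewrite opprK.
  by move=> /ts_itv_opp Ks ts; rewrite ts_sigma_opp E E'; apply: rG => //; rewrite -E'.
split=> -[cG dG]; split.
- exact: (cN _ (fun t => G (- t))).1 ((within_continuous_opp _ _ _ _ _).1 cG).
- move=> t /ts_itv_opp Kt tb; rewrite -[X in is_delta_derivative _ _ _ _ X]opprK.
  by apply/dE; apply: dG => //; rewrite ltrNr.
- exact: (within_continuous_opp _ _ _ _ _).2 ((cN _ (fun t => G (- t))).2 cG).
- move=> t Kt ta; apply/dE; have := dG (- t); rewrite /= opprK; apply.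
    by apply/ts_itv_opp; rewrite opprK.
  by rewrite ltrN2.
Qed.

Lemma nabla_integral_opp (R : realType) (T : set R) (a b : R) (f : R -> R) :
  closed T -> T a -> T b -> a < b -> {within ts_itv T a b, continuous f} ->
  nabla_integral T a b f =
  delta_integral (ts_opp T) (- b) (- a) (fun t => f (- t)).
Proof.
move=> cT Ta Tb ab cf.
have cT' := closed_ts_opp _ _ cT.
have Ta' : ts_opp T (- a) by rewrite /ts_opp /= opprK.
have Tb' : ts_opp T (- b) by rewrite /ts_opp /= opprK.
have ab' : - b < - a by rewrite ltrN2.
rewrite /nabla_integral /=; set G := xget _ _.
have /nabla_antiderivative_opp aG : nabla_antiderivative T a b f G.
  rewrite /G; apply: xgetPex.
  have cf' := (within_continuous_opp _ _ _ _ _).1 cf.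
  have [F aF] := @delta_antiderivative_exists _ _ _ _ cT' Tb' Ta' ab' _ cf'.
  exists (fun t => - F (- t)); apply/nabla_antiderivative_opp.
  by rewrite (_ : (fun t => - - F (- - t)) = F)//; apply/funext => t; rewrite !opprK.
by rewrite (delta_integralE _ _ _ _ _ _ cT' Tb' Ta' ab' aG) !opprK addrC.
Qed.

Lemma nabla_integral_le_lin (R : realType) (T : set R) (a b : R)
    (f g h : R -> R) (k l : R) :
  closed T -> T a -> T b -> a < b ->
  {within ts_itv T a b, continuous f} -> {within ts_itv T a b, continuous g} ->
  {within ts_itv T a b, continuous h} ->
  (forall t, ts_itv T a b t -> f t <= k * g t + l * h t) ->
  nabla_integral T a b f <=
    k * nabla_integral T a b g + l * nabla_integral T a b h.
Proof.
move=> cT Ta Tb ab cf cg ch fgh; rewrite !nabla_integral_opp//.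
apply: delta_integral_le_lin; rewrite ?ltrN2//; first exact: closed_ts_opp.
- by rewrite /ts_opp /= opprK.
- by rewrite /ts_opp /= opprK.
- exact: (within_continuous_opp _ _ _ _ _).1.
- exact: (within_continuous_opp _ _ _ _ _).1.
- exact: (within_continuous_opp _ _ _ _ _).1.
- by move=> t /ts_itv_opp; exact: fgh.
Qed.

(** * The diamond integral *)

Lemma diamond_integral_le_lin (R : realType) (T : set R) (alpha a b : R)
    (f g h : R -> R) (k l : R) :
  0 <= alpha <= 1 -> closed T -> T a -> T b -> a < b ->
  {within ts_itv T a b, continuous f} -> {within ts_itv T a b, continuous g} ->
  {within ts_itv T a b, continuous h} ->
  (forall t, ts_itv T a b t -> f t <= k * g t + l * h t) ->
  diamond_integral T alpha a b f <=
    k * diamond_integral T alpha a b g + l * diamond_integral T alpha a b h.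
Proof.
move=> /andP[a0 a1] cT Ta Tb ab cf cg ch fgh; rewrite /diamond_integral.
have hd := @delta_integral_le_lin _ _ _ _ _ _ _ _ _ cT Ta Tb ab cf cg ch fgh.
have hn := @nabla_integral_le_lin _ _ _ _ _ _ _ _ _ cT Ta Tb ab cf cg ch fgh.
have {}a1 : 0 <= 1 - alpha by lra.
have := lerD (ler_wpM2l a0 hd) (ler_wpM2l a1 hn).
by rewrite !mulrDr; lra.
Qed.

Lemma diamond_integral_ge0 (R : realType) (T : set R) (alpha a b : R) (f : R -> R) :
  0 <= alpha <= 1 -> closed T -> T a -> T b -> a < b ->
  {within ts_itv T a b, continuous f} -> (forall t, ts_itv T a b t -> 0 <= f t) ->
  0 <= diamond_integral T alpha a b f.
Proof.
move=> a01 cT Ta Tb ab cf f0.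
(* Integrating this bound gives [I <= 2 * I] for the integral [I] of [f], that is, [0 <= I]. *)
have ff t : ts_itv T a b t -> f t <= 2 * f t + 0 * f t.
  by move=> Kt; have := f0 t Kt; lra.
have := @diamond_integral_le_lin _ _ _ _ _ _ _ _ _ _ a01 cT Ta Tb ab cf cf cf ff; lra.
Qed.

(** * Powers of absolute values, and the norm inequality *)

Lemma continuous_norm_powR (R : realType) (p : R) : 0 < p ->
  continuous (fun x : R => `|x| `^ p).
Proof.
(* Differentiability of the power covers only nonzero [x]; at 0 the radius [e] to the power [1/p] is
   explicit. *)
move=> p0 x; have [->|x0] := eqVneq x 0.
  apply/cvgrPdist_lt => e e0; rewrite normr0 powR0 ?gt_eqF//.
  apply/nbhs_normP; exists (e `^ p^-1); first by rewrite /= powR_gt0.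
  move=> y /=; rewrite !sub0r !normrN => ye.
  rewrite ger0_norm ?powR_ge0//.
  have -> : e = (e `^ p^-1) `^ p by rewrite -powRrM mulVf ?gt_eqF// powRr1// ltW.
  by rewrite gt0_ltr_powR// nnegrE ?powR_ge0.
have nx0 : 0 < `|x| by rewrite normr_gt0.
apply: (@continuous_comp _ _ _ (fun x : R => `|x|) (fun y => y `^ p)).
  exact: norm_continuous.
apply: differentiable_continuous; apply/derivable1_diffP.
by apply: derivable_powR; rewrite in_itv /= nx0.
Qed.

(** Convexity of the power is applied at [|x|/u] and [|y|/v], whose combination with weights
    [u/(u+v)] and [v/(u+v)] is [(|x|+|y|)/(u+v)]. The coefficients do not depend on [x] and [y], so
    the bound can be integrated. *)
Lemma powR_norm_weighted (R : realType) (p u v x y : R) : 1 <= p -> 0 < u -> 0 < v ->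
  `|x + y| `^ p <= (u + v) `^ p * (u / (u + v)) / u `^ p * `|x| `^ p +
                   (u + v) `^ p * (v / (u + v)) / v `^ p * `|y| `^ p.
Proof.
move=> p1 u0 v0; have uv0 : 0 < u + v by rewrite addr_gt0.
have p0 : 0 <= p by lra.
have w0 : 0 <= u / (u + v) by rewrite divr_ge0 ?ltW.
have w1 : u / (u + v) <= 1 by rewrite ler_pdivrMr// mul1r lerDl ltW.
pose w : {i01 R} := Itv01 w0 w1.
have := @convex_powR R p p1 w (`|x| / u) (`|y| / v).
rewrite !inE /= !in_itv /= !andbT !divr_ge0 ?(ltW u0) ?(ltW v0)// => /(_ isT isT).
rewrite convRE [X in X `^ _ <= _ -> _]convRE /= /unstable.onem.
have -> : 1 - u / (u + v) = v / (u + v) by field; rewrite gt_eqF.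
have -> : u / (u + v) * (`|x| / u) + v / (u + v) * (`|y| / v) = (`|x| + `|y|) / (u + v).
  by field; rewrite !gt_eqF.
move=> h.
apply: (@le_trans _ _ ((`|x| + `|y|) `^ p)).
  by apply: ge0_ler_powR; rewrite ?nnegrE ?addr_ge0 ?ler_normD.
have -> : `|x| + `|y| = (u + v) * ((`|x| + `|y|) / (u + v)) by field; rewrite gt_eqF.
have divE z r : 0 < r -> (`|z| / r) `^ p = `|z| `^ p / r `^ p.
  move=> r0; rewrite powRM// ?invr_ge0 ?ltW//; congr (_ * _).
  by rewrite -[r^-1]powR_inv1 ?(ltW r0)// -powRrM mulN1r powRN.
rewrite powRM ?divr_ge0 ?addr_ge0 ?(ltW uv0) ?(ltW u0) ?(ltW v0)//.
have := ler_wpM2l (powR_ge0 (u + v) p) h.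
rewrite !divE//; set L := _ * _ `^ p => /le_trans; apply.
by rewrite le_eqVlt; apply/orP; left; apply/eqP; rewrite mulrDr; ring.
Qed.

Theorem mainTheorem3 (R : realType) (T : set R) (a b alpha p : R)
    (f g : R -> R)
    (hT : is_time_scale T) (ha : T a) (hb : T b) (hab : a < b)
    (halpha : 0 <= alpha <= 1)
    (hf : {within ts_itv T a b, continuous f})
    (hg : {within ts_itv T a b, continuous g})
    (hp : 1 < p) :
  diamond_integral T alpha a b (fun t => `|f t + g t| `^ p) `^ (1 / p) <=
  diamond_integral T alpha a b (fun t => `|f t| `^ p) `^ (1 / p) +
  diamond_integral T alpha a b (fun t => `|g t| `^ p) `^ (1 / p).
Proof.
have [_ cT] := hT; have p0 : 0 < p by lra.
have cp (h : R -> R) : {within ts_itv T a b, continuous h} ->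
    {within ts_itv T a b, continuous (fun t => `|h t| `^ p)}.
  move=> /subspace_continuousP ch; apply/subspace_continuousP => t Kt.
  apply: (cvg_comp _ (fun x : R => `|x| `^ p) (ch t Kt)).
  exact: continuous_norm_powR.
have hfg : {within ts_itv T a b, continuous (fun t => f t + g t)}.
  move/subspace_continuousP: hf => cf; move/subspace_continuousP: hg => cg.
  by apply/subspace_continuousP => t Kt; apply: cvgD; [exact: cf|exact: cg].
have I0 (h : R -> R) : {within ts_itv T a b, continuous h} ->
    0 <= diamond_integral T alpha a b (fun t => `|h t| `^ p).
  move=> ch; apply: (@diamond_integral_ge0 _ T _ _ _ _ halpha cT ha hb hab (cp h ch)) => t _.
  exact: powR_ge0.
have root (x y : R) : 0 <= x -> 0 <= y -> x `^ (1 / p) <= y -> x <= y `^ p.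
  move=> x0 y0 xy; have -> : x = (x `^ (1 / p)) `^ p.
    by rewrite -powRrM divfK ?gt_eqF// powRr1.
  by apply: ge0_ler_powR; rewrite ?nnegrE ?powR_ge0// ltW.
have := @diamond_integral_le_lin _ T alpha a b _ _ _ _ _ halpha cT ha hb hab
   (cp _ hfg) (cp _ hf) (cp _ hg).
have := I0 _ hfg; have := I0 _ hf; have := I0 _ hg.
(* The patterns are generalized from right to left, so the wildcard [Y] is the remaining integral,
   that of [|g|^p]. *)
move: (diamond_integral _ _ _ _ _) (diamond_integral _ _ _ _ (fun t => `|f t| `^ p))
  (diamond_integral _ _ _ _ (fun t => `|f t + g t| `^ p)) => Y X Z Y0 X0 Z0 hZ.
apply/ler_addgt0Pr => e e0.
(* The norms of [f] and [g] may vanish; adding [e / 2] to each makes it a legitimate divisor. *)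
pose u := X `^ (1 / p) + e / 2; pose v := Y `^ (1 / p) + e / 2.
have u0 : 0 < u by rewrite ltr_wpDl ?powR_ge0 ?divr_gt0.
have v0 : 0 < v by rewrite ltr_wpDl ?powR_ge0 ?divr_gt0.
rewrite (_ : _ + _ + e = u + v); last by rewrite /u /v; lra.
have uv0 : 0 < u + v by rewrite addr_gt0.
have Xu : X / u `^ p <= 1.
  rewrite ler_pdivrMr ?powR_gt0// mul1r; apply: root => //; first exact: ltW.
  by rewrite /u; lra.
have Yv : Y / v `^ p <= 1.
  rewrite ler_pdivrMr ?powR_gt0// mul1r; apply: root => //; first exact: ltW.
  by rewrite /v; lra.
suff Zuv : Z <= (u + v) `^ p.
  have -> : u + v = ((u + v) `^ p) `^ (1 / p).
    by rewrite -powRrM mulrC divfK ?gt_eqF// powRr1// ltW.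
  by apply: ge0_ler_powR; rewrite ?nnegrE ?powR_ge0// divr_ge0// ltW.
have := hZ _ _ (fun t _ => @powR_norm_weighted _ p u v (f t) (g t) (ltW hp) u0 v0).
move=> /le_trans; apply.
have le z w W : 0 < z -> W / w <= 1 ->
    (u + v) `^ p * (z / (u + v)) / w * W <= (u + v) `^ p * (z / (u + v)).
  move=> z0 Ww; rewrite -[_ / w * W]mulrA [w^-1 * W]mulrC ler_piMr//.
  by rewrite mulr_ge0 ?powR_ge0// divr_ge0// ltW.
(* The normalized integrals are at most 1, and the weights [u/(u+v)] and [v/(u+v)] sum to 1. *)
apply: le_trans (lerD (le _ _ _ u0 Xu) (le _ _ _ v0 Yv)) _.
by rewrite -mulrDr -mulrDl divff ?mulr1// gt_eqF.
Qed.
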